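(* Let $\mathscr{C}$ be a finitely complete category endowed with a Grothendieck topology $J$, let $\mathfrak{F}$ be a filter on $\mathscr{C}$, let $C$ be an object of $\mathscr{C}$ and let $p:1\to C$ be a point of $C$. Then $p$ is a cluster point of $\mathfrak{F}(C)$ if and only if there is a filter $\mathscr{G}$ on $\mathscr{C}$ finer than $\mathfrak{F}$ such that $\mathscr{G}(C)$ converges to $p$.
   Context: A sieve on an object $C$ is a family $S$ of morphisms of $\mathscr{C}$ with codomain $C$ such that $f\in S$ implies $f\circ g\in S$ whenever the composite is defined; sieves on $C$ are ordered by inclusion. $J(C)$ denotes the collection of covering sieves on $C$ for $J$. A filter on $\mathscr{C}$ is a function $\mathfrak{F}$ assigning to each object $C$ of $\mathscr{C}$ a collection $\mathfrak{F}(C)$ of sieves on $C$ such that: (F1) if $S\in\mathfrak{F}(C)$ and $R$ is a sieve on $C$ with $S\subseteq R$, then $R\in\mathfrak{F}(C)$; (F2) every finite intersection of sieves of $\mathfrak{F}(C)$ belongs to $\mathfrak{F}(C)$; (F3) the empty sieve is not in $\mathfrak{F}(C)$. A filter $\mathfrak{F}_2$ is finer than a filter $\mathfrak{F}_1$ if $\mathfrak{F}_1(C)\subseteq\mathfrak{F}_2(C)$ for all objects $C$ (equality allowed). A point of $C$ is a morphism $p:1\to C$, where $1$ is a terminal object. A $\mathfrak{G}$-neighborhood of $p$ is a sieve $V\in J(C)$ for which there exist a morphism $\phi:D\to C$ in $V$ and a point $q:1\to D$ with $\phi\circ q=p$. A cover-neighborhood of $p$ is a sieve on $C$ that contains some $\mathfrak{G}$-neighborhood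 of $p$; $\mathscr{N}_p(C)$ is the collection of all cover-neighborhoods of $p$. For a filter $\mathscr{G}$, $\mathscr{G}(C)$ converges to $p$ if $\mathscr{N}_p(C)\subseteq\mathscr{G}(C)$. The closure of a sieve $A$ on $C$ is the collection of all points $p$ of $C$ such that every cover-neighborhood of $p$ meets $A$ (two sieves on $C$ meet if their intersection is not the empty sieve). A point $p$ of $C$ is a cluster point of $\mathfrak{F}(C)$ if it lies in the closure of every sieve in $\mathfrak{F}(C)$. *)

(* Defs.v *)
From mathcomp Require Import all_boot.
From mathcomp Require Import boolp classical_sets functions cardinality.

Set Implicit Arguments.
Unset Strict Implicit.
Unset Printing Implicit Defensive.

Local Open Scope classical_set_scope.

Declare Scope cat_scope.
Delimit Scope cat_scope with cat.
Local Open Scope cat_scope.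


Record category := Category {
  obj :> Type;
  hom : obj -> obj -> Type;
  idmap : forall X, hom X X;
  comp : forall X Y Z, hom Y Z -> hom X Y -> hom X Z;
  comp1m : forall X Y (f : hom X Y), comp (idmap Y) f = f;
  compm1 : forall X Y (f : hom X Y), comp f (idmap X) = f;
  compA : forall X Y Z W (h : hom Z W) (g : hom Y Z) (f : hom X Y),
    comp h (comp g f) = comp (comp h g) f }.

Arguments hom {c} X Y.
Arguments idmap {c} X.
Arguments comp {c X Y Z} g f.

Notation "X ~> Y" := (hom X Y) (at level 70, no associativity) : cat_scope.
Notation "g \oc f" := (comp g f)
  (at level 50, left associativity, format "g  \oc  f") : cat_scope.

Record functor (I C : category) := Functor {
  fobj :> I -> C;
  fmap : forall i j, (i ~> j) -> (fobj i ~> fobj j);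
  fmap1 : forall i, fmap (idmap i) = idmap (fobj i);
  fmapM : forall i j k (g : j ~> k) (f : i ~> j),
    fmap (g \oc f) = fmap g \oc fmap f }.

Arguments fmap {I C} f {i j} u : rename.

Record cone (I C : category) (F : functor I C) := Cone {
  apex : C;
  leg : forall i, apex ~> F i;
  leg_nat : forall i j (u : i ~> j), fmap F u \oc leg i = leg j }.

Arguments apex {I C F} c.
Arguments leg {I C F} c i.

Definition is_limit (I C : category) (F : functor I C) (L : cone F) : Prop :=
  forall K : cone F, exists! h : apex K ~> apex L,
    forall i, leg L i \oc h = leg K i.

Definition finite_category (I : category) : Prop :=
  finite_set [set: I] /\ forall i j : I, finite_set [set: i ~> j].

Definition finitely_complete (C : category) : Prop :=
  forall I : category, finite_category I ->
  forall F : functor I C, exists L : cone F, is_limit L.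

Definition is_terminal (C : category) (one : C) : Prop :=
  forall X : C, exists! f : X ~> one, True.

Record sieve (C : category) (X : C) := Sieve {
  arrows :> forall Y : C, set (Y ~> X);
  arrows_comp : forall Y Z (f : Y ~> X) (g : Z ~> Y),
    arrows f -> arrows (f \oc g) }.

Arguments arrows {C X} s Y _.

Definition sieve_le (C : category) (X : C) (R S : sieve X) : Prop :=
  forall Y : C, R Y `<=` S Y.

Lemma sieve_eqP (C : category) (X : C) (R S : sieve X) :
  R = S <-> sieve_le R S /\ sieve_le S R.
Proof.
split=> [->|[]]; first by split=> Y f.
case: R S => [R hR] [S hS] RS SR.
have E : R = S.
  apply: functional_extensionality_dep => Y.
  by apply/seteqP; split; [exact: RS|exact: SR].
by subst S; congr Sieve; exact: Prop_irrelevance.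
Qed.

Definition sieve0 (C : category) (X : C) : sieve X :=
  @Sieve C X (fun _ => set0) (fun _ _ _ _ => id).

Definition sieveT (C : category) (X : C) : sieve X :=
  @Sieve C X (fun _ => setT) (fun _ _ _ _ _ => I).

Lemma sieve_bigcap_subproof (C : category) (X : C) (T : Type)
    (S : T -> sieve X) (Y Z : C) (f : Y ~> X) (g : Z ~> Y) :
  (\bigcap_t S t Y) f -> (\bigcap_t S t Z) (f \oc g).
Proof. by move=> Sf t _; apply/arrows_comp/Sf. Qed.

Definition sieve_bigcap (C : category) (X : C) (T : Type) (S : T -> sieve X) :
    sieve X :=
  Sieve (sieve_bigcap_subproof (S := S)).

Lemma sieveI_subproof (C : category) (X : C) (R S : sieve X)
    (Y Z : C) (f : Y ~> X) (g : Z ~> Y) :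
  (R Y `&` S Y) f -> (R Z `&` S Z) (f \oc g).
Proof. by case=> Rf Sf; split; exact: arrows_comp. Qed.

Definition sieveI (C : category) (X : C) (R S : sieve X) : sieve X :=
  Sieve (sieveI_subproof (R := R) (S := S)).

Lemma sieve_pullback_subproof (C : category) (X W : C) (h : W ~> X)
    (S : sieve X) (Y Z : C) (f : Y ~> W) (g : Z ~> Y) :
  S Y (h \oc f) -> S Z (h \oc (f \oc g)).
Proof. by rewrite compA; exact: arrows_comp. Qed.

Definition sieve_pullback (C : category) (X W : C) (h : W ~> X) (S : sieve X) :
    sieve W :=
  @Sieve C W (fun Y => [set f | S Y (h \oc f)])
    (sieve_pullback_subproof (h := h) (S := S)).

Record grothendieck_topology (C : category) := GrothendieckTopology {
  covering :> forall X : C, set (sieve X);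
  covering_max : forall X, covering (sieveT X);
  covering_stable : forall X (S : sieve X) Y (h : Y ~> X),
    covering S -> covering (sieve_pullback h S);
  covering_trans : forall X (S R : sieve X), covering S ->
    (forall Y (h : Y ~> X), S Y h -> covering (sieve_pullback h R)) ->
    covering R }.

Arguments covering {C} J X _ : rename.

(* [sfilter_cap] includes the nullary intersection (n = 0), so that the
   maximal sieve on X belongs to the filter at X. *)
Record sieve_filter (C : category) := SieveFilter {
  sfilter :> forall X : C, set (sieve X);
  sfilter_up : forall X (S R : sieve X),
    sfilter S -> sieve_le S R -> sfilter R;
  sfilter_cap : forall X (n : nat) (S : 'I_n -> sieve X),
    (forall i, sfilter (S i)) -> sfilter (sieve_bigcap S);
  sfilter_neq0 : forall X, ~ sfilter (sieve0 X) }.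

Arguments sfilter {C} F X _ : rename.

Definition finer (C : category) (F2 F1 : sieve_filter C) : Prop :=
  forall X : C, F1 X `<=` F2 X.

(* In the definitions below [one] is meant to be a terminal object, so that a
   morphism [one ~> X] is a point of [X]. *)

Definition G_neighborhood (C : category) (J : grothendieck_topology C)
    (one X : C) (p : one ~> X) (V : sieve X) : Prop :=
  J X V /\
  exists (Y : C) (phi : Y ~> X) (q : one ~> Y), V Y phi /\ phi \oc q = p.

Definition cover_neighborhoods (C : category) (J : grothendieck_topology C)
    (one X : C) (p : one ~> X) : set (sieve X) :=
  [set N | exists V : sieve X, G_neighborhood J p V /\ sieve_le V N].

Definition converges_to (C : category) (J : grothendieck_topology C)
    (G : sieve_filter C) (one X : C) (p : one ~> X) : Prop :=
  cover_neighborhoods J p `<=` G X.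

Definition sieves_meet (C : category) (X : C) (R S : sieve X) : Prop :=
  sieveI R S <> sieve0 X.

Definition sieve_closure (C : category) (J : grothendieck_topology C)
    (one X : C) (A : sieve X) : set (one ~> X) :=
  [set p | forall N : sieve X, cover_neighborhoods J p N -> sieves_meet N A].

Definition cluster_point (C : category) (J : grothendieck_topology C)
    (F : sieve_filter C) (one X : C) (p : one ~> X) : Prop :=
  forall A : sieve X, F X A -> sieve_closure J A p.

(* Main.v *)
(** If [phi \oc q = p] with [phi] in the sieve [V], then [p] itself is in [V].
So the G-neighborhoods of [p] are the covering sieves containing [p], and they
are closed under finite intersections. If [p] is a cluster point, they meet
every member of [F X]; hence the sieves containing the intersection of a
G-neighborhood of [p] with a member of [F X] form a proper filter at [X]. As
the values of a filter at distinct objects are unrelated, replacing [F X] by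
it and keeping [F] elsewhere gives the required finer filter. *)
Require Import Defs.
From mathcomp Require Import all_boot.
From mathcomp Require Import boolp classical_sets functions cardinality.

Local Open Scope cat_scope.

Section Coverings.
Variables (C : category) (J : grothendieck_topology C).

(** Transitivity of [J] applies because pulling [R] back along an arrow of [S] gives the maximal
    sieve. *)
Lemma covering_up (X : C) (S R : sieve X) : J X S -> sieve_le S R -> J X R.
Proof.
move=> JS SR; apply: (covering_trans JS) => Y h Sh.
suff -> : sieve_pullback h R = sieveT Y by exact: covering_max.
by apply/sieve_eqP; split=> Z f //= _; exact/SR/arrows_comp.
Qed.

(** Induction on [n], by transitivity along [S ord0]: on an arrow [h] of [S ord0] membership in
    [S ord0] is automatic, so the pullback of the whole intersection contains that of the remaining
    sieves, which covers by stability. *)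
Lemma covering_bigcap (X : C) n (S : 'I_n -> sieve X) :
  (forall i, J X (S i)) -> J X (sieve_bigcap S).
Proof.
elim: n S => [|n IHn] S JS.
  by apply: covering_up (covering_max J X) _ => Y f _ [].
have Jrest := IHn _ (fun i => JS (lift ord0 i)).
apply: (covering_trans (JS ord0)) => Y h S0h.
apply: covering_up (covering_stable h Jrest) _ => Z f /= Sf i _.
case: (unliftP ord0 i) => [j|] ->; [exact: Sf | exact: arrows_comp].
Qed.

Lemma G_neighborhoodE (one X : C) (p : one ~> X) (V : sieve X) :
  G_neighborhood J p V <-> J X V /\ V one p.
Proof.
split=> -[JV]; first by case=> Y [phi [q [Vphi <-]]]; split=> //; exact: arrows_comp.
by move=> Vp; split=> //; exists one, p, (idmap one); split=> //; rewrite compm1.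
Qed.

End Coverings.

Section Filters.
Variables (C : category) (F : sieve_filter C) (X : C).

Lemma sfilterI (R S : sieve X) : F X R -> F X S -> F X (sieveI R S).
Proof.
move=> FR FS.
pose T (i : 'I_2) := if i == ord0 then R else S.
have FT : F X (sieve_bigcap T) by apply: sfilter_cap => i; rewrite /T; case: ifP.
by apply: sfilter_up FT _ => Y f Tf; split; [exact: (Tf ord0)|exact: (Tf ord_max)].
Qed.

Variable B : set (sieve X).
Hypothesis B_up : forall S R : sieve X, B S -> sieve_le S R -> B R.
Hypothesis B_cap : forall n (S : 'I_n -> sieve X),
  (forall i, B (S i)) -> B (sieve_bigcap S).
Hypothesis B_neq0 : ~ B (sieve0 X).

(** Two implications avoid a case split on [Y = X] inside the definition; the transport lets [B],
    which only speaks of sieves on [X], apply to [S]. *)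
Definition replaced_at (Y : C) : set (sieve Y) := fun S =>
  (Y <> X -> F Y S) /\ forall e : Y = X, B (eq_rect Y (@sieve C) S X e).

Lemma replaced_atE (S : sieve X) : replaced_at X S <-> B S.
Proof.
split=> [[_ /(_ erefl)] //|BS]; split=> // e.
by rewrite (Prop_irrelevance e erefl).
Qed.

Lemma replaced_at_neq (Y : C) (S : sieve Y) :
  Y <> X -> replaced_at Y S <-> F Y S.
Proof. by move=> YX; split=> [[/(_ YX)]|]. Qed.

Lemma sieve_filter_replace : exists G : sieve_filter C,
  (forall S, G X S <-> B S) /\ forall Y S, Y <> X -> (G Y S <-> F Y S).
Proof.
have up Y (S R : sieve Y) :
    replaced_at Y S -> sieve_le S R -> replaced_at Y R.
  have [e|YX] := pselect (Y = X).
    by subst Y; rewrite !replaced_atE; exact: B_up.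
  by rewrite !replaced_at_neq//; exact: sfilter_up.
have cap Y n (S : 'I_n -> sieve Y) :
    (forall i, replaced_at Y (S i)) -> replaced_at Y (sieve_bigcap S).
  have [e|YX] := pselect (Y = X) => GS.
    by subst Y; apply/replaced_atE/B_cap => i; exact/replaced_atE.
  by apply/replaced_at_neq => //; apply: sfilter_cap => i; exact/replaced_at_neq.
have neq0 Y : ~ replaced_at Y (sieve0 Y).
  have [e|YX] := pselect (Y = X); first by subst Y; rewrite replaced_atE.
  by rewrite replaced_at_neq//; exact: sfilter_neq0.
exists (SieveFilter up cap neq0); split; first exact: replaced_atE.
by move=> Y S; exact: replaced_at_neq.
Qed.

End Filters.

Theorem theorem4p5 (C : category) (hC : finitely_complete C)
    (J : grothendieck_topology C) (F : sieve_filter C)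
    (one : C) (one_terminal : is_terminal one) (X : C) (p : one ~> X) :
  cluster_point J F p <->
  exists G : sieve_filter C, finer G F /\ converges_to J G p.
Proof.
split=> [clFp|[G [GF Gp]] A FA N Np NA0]; last first.
  apply: (@sfilter_neq0 _ G X); rewrite -NA0.
  by apply: sfilterI; [exact: Gp|exact: GF].
(* The two witnesses are packed in a pair so that a single use of [choice] yields both families in
   [B_cap]. *)
pose B (S : sieve X) := exists VA : sieve X * sieve X,
  [/\ G_neighborhood J p VA.1, F X VA.2 & sieve_le (sieveI VA.1 VA.2) S].
have B_up S R : B S -> sieve_le S R -> B R.
  move=> [VA [Vp FA VAS]] SR; exists VA; split=> // Y f VAf.
  exact/SR/VAS.
have B_cap n (S : 'I_n -> sieve X) : (forall i, B (S i)) -> B (sieve_bigcap S).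
  move=> /choice[VA BVA].
  exists (sieve_bigcap (fun i => (VA i).1), sieve_bigcap (fun i => (VA i).2)).
  split=> /=.
  - apply/G_neighborhoodE; split.
      by apply: covering_bigcap => i; have [/G_neighborhoodE[]] := BVA i.
    by move=> i _; have [/G_neighborhoodE[]] := BVA i.
  - by apply: sfilter_cap => i; have [] := BVA i.
  - move=> Y f [Vf Af] i _; have [_ _] := BVA i.
    by apply; split; [exact: Vf|exact: Af].
have B_neq0 : ~ B (sieve0 X).
  move=> [[V A] [/= Vp FA VA0]].
  have Vnbhd : cover_neighborhoods J p V by exists V; split=> // Y f.
  by apply: (clFp A FA V Vnbhd); apply/sieve_eqP; split.
have [G [GX GF]] := @sieve_filter_replace _ F X B B_up B_cap B_neq0.
exists G; split.
- move=> Y S FS; have [e|YX] := pselect (Y = X); last exact/GF.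
  (* The maximal sieve covers and contains [p], hence is a G-neighborhood of [p]. *)
  subst Y; apply/GX; exists (sieveT X, S); split=> //=; last by move=> Y f [].
  by apply/G_neighborhoodE; split=> //; exact: covering_max.
- move=> N [V [Vp VN]]; apply/GX; exists (V, sieveT X); split=> //=.
    (* The empty intersection, indexed by ['I_0], puts the maximal sieve in [F X]. *)
    have FT : F X (sieve_bigcap (fun i : 'I_0 => sieveT X)).
      by apply: sfilter_cap => -[].
    exact: sfilter_up FT _.
  by move=> Y f [/VN].
Qed.
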